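(* Let $W=W_{A_{n-1}}=S_n$ and let $M$ be a $(\mathcal C_{2n}\rtimes\mathbb C W)$-module. The action of $y_i$ on the $\mathbb H^{cc}_W$-module $\mathbb C[x_1,\dots,x_n]\otimes M$ is realized as the following Dunkl operator: for any $f\in\mathbb C[x_1,\dots,x_n]$ and $m\in M$, $$y_i\circ(f\otimes m)=tc_ie_i\frac{f-f^{\tau_i}}{2x_i}\otimes m-u\sum_{k\ne i}\left(\frac{f-f^{s_{ki}}}{x_i-x_k}+\frac{f\,c_kc_i-c_kc_i\,f^{s_{ki}}}{x_i+x_k}\right)\otimes(1+e_ke_i)s_{ki}m.$$
   Context: All algebras are over $\mathbb C$; $[x,y]=xy-yx$. $s_{ij}\in S_n$ is the transposition of $i,j$. $S_n$ permutes the indices of the symbols $x_i,y_i,c_i,e_i$, written $a_i\mapsto a_i^\sigma$. For a polynomial $f$ in $x_1,\dots,x_n$, $f^{s_{ki}}$ is $f$ with $x_k,x_i$ exchanged, and $f^{\tau_i}$ is $f$ with $x_i$ replaced by $-x_i$. $\mathcal C_{2n}$ is the Clifford algebra generated by pairwise anticommuting $c_1,\dots,c_n,e_1,\dots,e_n$ of square $1$; $\mathcal C_{2n}\rtimes\mathbb C W$ is the smash product ($\sigma c_i=c_i^\sigma\sigma$, $\sigma e_i=e_i^\sigma\sigma$). Let $t,u\in\mathbb C$. $\mathbb H^{cc}_W$ (type $A_{n-1}$) is generated by $x_i,y_i$ ($1\le i\le n$), $\mathcal C_{2n}$ and $W$ subject to, for all $i,j$, $\sigma\in W$: $x_ix_j=x_jx_i$,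 $y_iy_j=y_jy_i$, $\sigma a_i=a_i^\sigma\sigma$ for $a=c,e,x,y$, $e_ix_j=x_je_i$, $c_ix_j=(-1)^{\delta_{ij}}x_jc_i$, $c_iy_j=y_jc_i$, $e_iy_j=(-1)^{\delta_{ij}}y_je_i$, and $[y_i,x_j]=u(1+c_ic_j)(1+e_je_i)s_{ij}$ ($i\ne j$), $\ [y_i,x_i]=tc_ie_i-u\sum_{k\ne i}(1+c_kc_i)(1+e_ke_i)s_{ki}$. The module: let $\mathfrak H_y\subset\mathbb H^{cc}_W$ be the subalgebra generated by $\mathcal C_{2n}\rtimes\mathbb C W$ and $y_1,\dots,y_n$. Extend $M$ to an $\mathfrak H_y$-module by letting each $y_i$ act by $0$, and form the induced module $\mathrm{Ind}_{\mathfrak H_y}^{\mathbb H^{cc}_W}M$, identified as a vector space with $\mathbb C[x_1,\dots,x_n]\otimes M$ ($f\otimes m$ corresponding to $f\cdot m$). Conventions in the formula: a ratio $\frac hg$ means $\frac1g\cdot h$ ($\frac1g$ multiplied on the left). Products of polynomials and elements of $\mathcal C_{2n}$ are taken using the relations of $\mathbb H^{cc}_W$, and for a polynomial $p$ and $b\in\mathcal C_{2n}$ one sets $pb\otimes m=p\otimes bm$. (So $c_kc_if^{s_{ki}}=g\,c_kc_i$ with $g$ obtained from $f^{s_{ki}}$ by $x_i\mapsto-x_i$, $x_k\mapsto-x_k$, and all the ratios are polynomials times Clifford elements.) *)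

(* Defs.v *)
From HB Require Import structures.
From mathcomp Require Import all_boot all_order all_algebra all_fingroup.
From mathcomp Require Import generic_quotient ring_quotient.
From mathcomp Require Import boolp reals complex.
From mathcomp Require finmap monalg.
From mathcomp Require Import ssrcomplements mpoly.

Set Implicit Arguments.
Unset Strict Implicit.
Unset Printing Implicit Defensive.

Import Order.TTheory GRing.Theory Num.Theory.
Local Open Scope ring_scope.
Local Open Scope quotient_scope.

(* The K-algebra K<G> / (a = b, for rel a b). It is only a pzRingType with a
   compatible lmodType K structure, because an algType has 1 != 0, and that is
   not known for an arbitrary presentation. *)
Module Presented.
(* Locked for performance only: these block the unfolding of products in the
   quotient down to the free algebra. *)
Fact pi_key : unit. Proof. by []. Qed.
Fact mul_key : unit. Proof. by []. Qed.
Fact scale_key : unit. Proof. by []. Qed.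

Import monalg.

Lemma malg_scaleAr (K : comNzRingType) (G : monomType) k (a b : {malg K[G]}) :
  k *: (a * b) = a * (k *: b).
Proof.
apply/malgP => m; rewrite mcoeffZ (mcoeffMl a b).
rewrite (mcoeffMlw m (finmap.fsubset_refl _) (msuppZ_le k b)).
rewrite mulr_sumr; apply: eq_bigr => m1 _.
rewrite mulr_sumr; apply: eq_bigr => m2 _.
by rewrite mcoeffZ mulrnAr mulrCA.
Qed.

Section Presented.
Variables (K : fieldType) (G : choiceType).

Definition freealg : lalgType K := {malg K[{fmonom G}]}.
Definition freegen (g : G) : freealg := << fmu g >>.

Variable rel : freealg -> freealg -> Prop.

Inductive ideal : freealg -> Prop :=
| ideal_rel a b : rel a b -> ideal (a - b)
| ideal0 : ideal 0
| idealD a b : ideal a -> ideal b -> ideal (a + b)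
| idealMl a b : ideal b -> ideal (a * b)
| idealMr a b : ideal a -> ideal (a * b).

Definition ideal_pred : {pred freealg} := fun a => `[< ideal a >].

Lemma ideal_predP a : reflect (ideal a) (a \in ideal_pred).
Proof. exact: asboolP. Qed.

Lemma ideal_zmod_closed : zmod_closed ideal_pred.
Proof.
split=> [|a b /ideal_predP Ia /ideal_predP Ib]; apply/ideal_predP.
  exact: ideal0.
by apply: idealD => //; rewrite -mulN1r; apply: idealMl.
Qed.
#[export] HB.instance Definition _ := GRing.isZmodClosed.Build freealg ideal_pred
  ideal_zmod_closed.

Definition alg := Quotient.quot ideal_pred.
#[export] HB.instance Definition _ := GRing.Zmodule.on alg.

Definition pi : freealg -> alg :=
  locked_with pi_key (fun a => \pi_(Quotient.quot ideal_pred) a).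
Canonical pi_unlockable := [unlockable fun pi].

Lemma pi_eq a b : ideal (a - b) <-> pi a = pi b.
Proof.
rewrite unlock; split=> [Iab|/eqP]; first by apply/eqP; rewrite -Quotient.idealrBE; apply/ideal_predP.
by rewrite -Quotient.idealrBE => /ideal_predP.
Qed.

Lemma piK (a : alg) : pi (repr a) = a.
Proof. by rewrite unlock reprK. Qed.

Lemma piB a b : pi (a - b) = pi a - pi b.
Proof. by rewrite unlock !piE. Qed.

Lemma piD a b : pi (a + b) = pi a + pi b.
Proof. by rewrite unlock !piE. Qed.

Lemma piN a : pi (- a) = - pi a.
Proof. by apply/(addrI (pi a)); rewrite -piD !subrr -(subrr a) piB subrr. Qed.

Definition one : alg := pi 1.
Definition mul : alg -> alg -> alg :=
  locked_with mul_key (fun a b => pi (repr a * repr b)).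
Canonical mul_unlockable := [unlockable fun mul].
Definition scale : K -> alg -> alg :=
  locked_with scale_key (fun k a => pi (k *: repr a)).
Canonical scale_unlockable := [unlockable fun scale].

Lemma repr_ideal a : ideal (repr (pi a) - a).
Proof. by apply/pi_eq; rewrite piK. Qed.

Lemma mul_pi a b : mul (pi a) (pi b) = pi (a * b).
Proof.
rewrite [mul]unlock; apply/pi_eq.
have -> : repr (pi a) * repr (pi b) - a * b
    = (repr (pi a) - a) * repr (pi b) + a * (repr (pi b) - b).
  by rewrite mulrBl mulrBr addrA subrK.
by apply: idealD; [apply: idealMr | apply: idealMl]; apply: repr_ideal.
Qed.

Lemma scale_pi k a : scale k (pi a) = pi (k *: a).
Proof.
rewrite [scale]unlock; apply/pi_eq; rewrite -scalerBr -[X in k *: X]mul1r scalerAl.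
by apply: idealMl; apply: repr_ideal.
Qed.

Lemma mulA : associative mul.
Proof.
by move=> a b c; rewrite -[a]piK -[b]piK -[c]piK !mul_pi mulrA.
Qed.
Lemma mul1 : left_id one mul.
Proof. by move=> a; rewrite -[a]piK mul_pi mul1r. Qed.
Lemma mulr1_ : right_id one mul.
Proof. by move=> a; rewrite -[a]piK mul_pi mulr1. Qed.
Lemma mulDl : left_distributive mul +%R.
Proof.
by move=> a b c; rewrite -[a]piK -[b]piK -[c]piK -piD !mul_pi mulrDl piD.
Qed.
Lemma mulDr : right_distributive mul +%R.
Proof.
by move=> a b c; rewrite -[a]piK -[b]piK -[c]piK -piD !mul_pi mulrDr piD.
Qed.
#[export] HB.instance Definition _ :=
  GRing.Zmodule_isPzRing.Build alg mulA mul1 mulr1_ mulDl mulDr.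

Lemma scaleA k l a : scale k (scale l a) = scale (k * l) a.
Proof. by rewrite -[a]piK !scale_pi scalerA. Qed.
Lemma scale1 : left_id 1 scale.
Proof. by move=> a; rewrite -[a]piK scale_pi scale1r. Qed.
Lemma scaleDr : right_distributive scale +%R.
Proof.
by move=> k a b; rewrite -[a]piK -[b]piK -piD !scale_pi scalerDr piD.
Qed.
Lemma scaleDl a : {morph scale^~ a : k l / k + l}.
Proof. by move=> k l; rewrite /= -[a]piK !scale_pi scalerDl piD. Qed.
#[export] HB.instance Definition _ :=
  GRing.Zmodule_isLmodule.Build K alg scaleA scale1 scaleDr scaleDl.

Lemma algM a b : pi (a * b) = pi a * pi b.
Proof. by rewrite -mul_pi. Qed.
Lemma algZ k a : pi (k *: a) = k *: pi a.
Proof. by rewrite -scale_pi. Qed.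
Lemma alg1 : pi 1 = 1.
Proof. by []. Qed.

Lemma algZAl k (a b : alg) : k *: (a * b) = (k *: a) * b.
Proof. by rewrite -[a]piK -[b]piK -algM -algZ scalerAl algM algZ. Qed.

Lemma algZAr k (a b : alg) : k *: (a * b) = a * (k *: b).
Proof. by rewrite -[a]piK -[b]piK -algM -algZ malg_scaleAr algM algZ. Qed.

Lemma pi_rel a b : rel a b -> pi a = pi b.
Proof. by move=> ab; apply/pi_eq/ideal_rel. Qed.

Lemma pi_relM a b c d : rel (a * b) (c * d) -> pi a * pi b = pi c * pi d.
Proof. by move=> /pi_rel ab; rewrite -(algM a b) -(algM c d). Qed.

Lemma pi_relMsign a b (s : bool) c d : rel (a * b) ((-1) ^+ s * (c * d)) ->
  pi a * pi b = (if s then - pi c else pi c) * pi d.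
Proof.
move=> /pi_rel ab; rewrite -(algM a b) ab; case: s {ab}.
  by rewrite [RHS]mulNr -(algM c d) -(piN (c * d)) mulN1r.
by rewrite -(algM c d) mul1r.
Qed.

Definition gen (g : G) : alg := pi (freegen g).

End Presented.

Module Exports.
HB.reexport.
End Exports.
End Presented.
Export Presented.Exports.

(* Permutations are composed right to left in S_n, so that a_i^sigma is
   a_(sigma i); MathComp's (tau * sigma)%g is "first tau, then sigma". *)
Inductive smash_rel (A : pzRingType) (n : nat) (c e : 'I_n -> A)
    (s : 'S_n -> A) : A -> A -> Prop :=
| smash_cc i j : i != j -> smash_rel c e s (c i * c j) (- (c j * c i))
| smash_ee i j : i != j -> smash_rel c e s (e i * e j) (- (e j * e i))
| smash_ce i j : smash_rel c e s (c i * e j) (- (e j * c i))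
| smash_c2 i : smash_rel c e s (c i * c i) 1
| smash_e2 i : smash_rel c e s (e i * e i) 1
| smash_s1 : smash_rel c e s (s 1%g) 1
| smash_ss sigma tau :
    smash_rel c e s (s sigma * s tau) (s (tau * sigma)%g)
| smash_sc sigma i : smash_rel c e s (s sigma * c i) (c (sigma i) * s sigma)
| smash_se sigma i : smash_rel c e s (s sigma * e i) (e (sigma i) * s sigma).

Inductive hcc_rel (K : fieldType) (A : lalgType K) (n : nat) (t u : K)
    (x y c e : 'I_n -> A) (s : 'S_n -> A) : A -> A -> Prop :=
| hcc_smash a b : smash_rel c e s a b -> hcc_rel t u x y c e s a b
| hcc_xx i j : hcc_rel t u x y c e s (x i * x j) (x j * x i)
| hcc_yy i j : hcc_rel t u x y c e s (y i * y j) (y j * y i)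
| hcc_sx sigma i :
    hcc_rel t u x y c e s (s sigma * x i) (x (sigma i) * s sigma)
| hcc_sy sigma i :
    hcc_rel t u x y c e s (s sigma * y i) (y (sigma i) * s sigma)
| hcc_ex i j : hcc_rel t u x y c e s (e i * x j) (x j * e i)
| hcc_cx i j :
    hcc_rel t u x y c e s (c i * x j) ((-1) ^+ (i == j) * (x j * c i))
| hcc_cy i j : hcc_rel t u x y c e s (c i * y j) (y j * c i)
| hcc_ey i j :
    hcc_rel t u x y c e s (e i * y j) ((-1) ^+ (i == j) * (y j * e i))
| hcc_yx_neq i j : i != j ->
    hcc_rel t u x y c e s (y i * x j - x j * y i)
      (u *: ((1 + c i * c j) * (1 + e j * e i) * s (tperm i j)))
| hcc_yx_eq i :
    hcc_rel t u x y c e s (y i * x i - x i * y i)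
      (t *: (c i * e i)
       - u *: \sum_(k < n | k != i)
                (1 + c k * c i) * (1 + e k * e i) * s (tperm k i)).

Inductive smash_gen (n : nat) : Type :=
| SmashC of 'I_n | SmashE of 'I_n | SmashS of 'S_n.
HB.instance Definition _ n := gen_eqMixin (smash_gen n).
HB.instance Definition _ n := gen_choiceMixin (smash_gen n).

Inductive hcc_gen (n : nat) : Type :=
| HccX of 'I_n | HccY of 'I_n | HccC of 'I_n | HccE of 'I_n | HccS of 'S_n.
HB.instance Definition _ n := gen_eqMixin (hcc_gen n).
HB.instance Definition _ n := gen_choiceMixin (hcc_gen n).

Section Algebras.
Variables (K : fieldType) (n : nat).

(* C_2n >< K S_n *)
Definition smash_pres := let g := @Presented.freegen K (smash_gen n) in
  smash_rel (g \o @SmashC n) (g \o @SmashE n) (g \o @SmashS n).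
Definition smash := Presented.alg smash_pres.
HB.instance Definition _ := GRing.PzRing.on smash.
HB.instance Definition _ := GRing.Lmodule.on smash.

Definition smash_c i : smash := Presented.gen _ (SmashC i).
Definition smash_e i : smash := Presented.gen _ (SmashE i).
Definition smash_s sigma : smash := Presented.gen _ (SmashS sigma).

Variables t u : K.

Definition hcc_pres := let g := @Presented.freegen K (hcc_gen n) in
  hcc_rel t u (g \o @HccX n) (g \o @HccY n)
    (g \o @HccC n) (g \o @HccE n) (g \o @HccS n).
Definition hcc := Presented.alg hcc_pres.
HB.instance Definition _ := GRing.PzRing.on hcc.
HB.instance Definition _ := GRing.Lmodule.on hcc.

Definition hcc_x i : hcc := Presented.gen _ (HccX i).
Definition hcc_y i : hcc := Presented.gen _ (HccY i).
Definition hcc_c i : hcc := Presented.gen _ (HccC i).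
Definition hcc_e i : hcc := Presented.gen _ (HccE i).
Definition hcc_s sigma : hcc := Presented.gen _ (HccS sigma).

End Algebras.

(* hy_act h m m': h lies in H_y, the subalgebra generated by C_2n, S_n and the
   y_i, and acts on M, extended to H_y by y_i = 0, as m |-> m'.  This is a
   relation rather than a function of h because its single-valuedness rests on
   the PBW theorem for hcc. *)
Inductive hy_act (K : fieldType) (n : nat) (t u : K) (M : lmodType (smash K n)) :
    hcc n t u -> M -> M -> Prop :=
| hy_act_c i m : hy_act (hcc_c t u i) m (smash_c K i *: m)
| hy_act_e i m : hy_act (hcc_e t u i) m (smash_e K i *: m)
| hy_act_s sigma m : hy_act (hcc_s t u sigma) m (smash_s K sigma *: m)
| hy_act_y i m : hy_act (hcc_y t u i) m 0
| hy_act_scalar (k : K) m :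
    hy_act (k *: (1 : hcc n t u)) m (k *: (1 : smash K n) *: m)
| hy_actD a b m m1 m2 :
    hy_act a m m1 -> hy_act b m m2 -> hy_act (a + b) m (m1 + m2)
| hy_actM a b m m1 m2 :
    hy_act b m m1 -> hy_act a m1 m2 -> hy_act (a * b) m m2.

(* H (x)_(H_y) M: the list [:: (a_1, m_1); ..; (a_r, m_r)] stands for the
   element sum_i a_i (x) m_i. *)
Module Induced.
Fact pi_key : unit. Proof. by []. Qed.
Fact add_key : unit. Proof. by []. Qed.
Fact scale_key : unit. Proof. by []. Qed.

Section Induced.
Variables (K : fieldType) (n : nat) (t u : K) (M : lmodType (smash K n)).
Local Notation H := (hcc n t u).

Inductive equiv : seq (H * M) -> seq (H * M) -> Prop :=
| equiv_refl v : equiv v v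
| equiv_sym v w : equiv v w -> equiv w v
| equiv_trans v w z : equiv v w -> equiv w z -> equiv v z
| equiv_cat v v' w w' : equiv v v' -> equiv w w' -> equiv (v ++ w) (v' ++ w')
| equiv_comm v w : equiv (v ++ w) (w ++ v)
| equiv_0 m : equiv [:: (0, m)] [::]
| equiv_Dl a b m : equiv [:: (a + b, m)] [:: (a, m); (b, m)]
| equiv_Dr a m m' : equiv [:: (a, m + m')] [:: (a, m); (a, m')]
| equiv_bal a h m m' : hy_act h m m' -> equiv [:: (a * h, m)] [:: (a, m')].

Definition formal : Type := seq (H * M).
#[export] HB.instance Definition _ := gen_eqMixin formal.
#[export] HB.instance Definition _ := gen_choiceMixin formal.

Definition equivb (v w : formal) : bool := `[< equiv v w >].
Lemma equivb_equiv : equiv_class_of equivb.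
Proof.
split=> [v|v w|w v z]; first by apply/asboolP; apply: equiv_refl.
  by apply/asboolP/asboolP; apply: equiv_sym.
by move=> /asboolP vw /asboolP wz; apply/asboolP; apply: equiv_trans wz.
Qed.
Canonical equivb_rel := EquivRelPack equivb_equiv.
Canonical equivb_enc := defaultEncModRel equivb.

Definition ind : Type := {eq_quot equivb}.
#[export] HB.instance Definition _ := Choice.on ind.

Definition pi : formal -> ind :=
  locked_with pi_key (fun v => \pi_({eq_quot equivb}) v).
Canonical pi_unlockable := [unlockable fun pi].

Lemma pi_eq v w : equiv v w <-> pi v = pi w.
Proof.
rewrite unlock; split=> [vw|/eqP].
  by apply/eqP; rewrite piE; apply/asboolP.
by rewrite piE => /asboolP.
Qed.

Lemma piK (a : ind) : pi (repr a) = a.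
Proof. by rewrite unlock reprK. Qed.

Definition lmul (h : H) (v : formal) : formal := [seq (h * p.1, p.2) | p <- v].

Definition zero : ind := pi [::].
Definition add : ind -> ind -> ind :=
  locked_with add_key (fun a b => pi (repr a ++ repr b)).
Canonical add_unlockable := [unlockable fun add].
Definition scale : H -> ind -> ind :=
  locked_with scale_key (fun h a => pi (lmul h (repr a))).
Canonical scale_unlockable := [unlockable fun scale].
Definition opp (a : ind) : ind := scale (-1) a.

Lemma repr_pi v : equiv (repr (pi v)) v.
Proof. by apply/pi_eq; rewrite piK. Qed.

Lemma lmul_equiv h v w : equiv v w -> equiv (lmul h v) (lmul h w).
Proof.
elim=> {v w} [v|v w _ IH|v w z _ vw _ wz|v v' w w' _ vv _ ww|v w|m|a b m|a m m'
  |a g m m' gm] /=.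
- exact: equiv_refl.
- exact: equiv_sym.
- exact: equiv_trans wz.
- by rewrite /lmul !map_cat; apply: equiv_cat.
- by rewrite /lmul !map_cat; apply: equiv_comm.
- by rewrite mulr0; apply: equiv_0.
- by rewrite mulrDr; apply: equiv_Dl.
- exact: equiv_Dr.
- by rewrite mulrA; apply: equiv_bal.
Qed.

Lemma add_pi v w : add (pi v) (pi w) = pi (v ++ w).
Proof. by rewrite [add]unlock; apply/pi_eq; apply: equiv_cat; apply: repr_pi. Qed.
Lemma scale_pi h v : scale h (pi v) = pi (lmul h v).
Proof. by rewrite [scale]unlock; apply/pi_eq; apply: lmul_equiv; apply: repr_pi. Qed.

Lemma addA : associative add.
Proof. by move=> a b c; rewrite -[a]piK -[b]piK -[c]piK !add_pi catA. Qed.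
Lemma addC : commutative add.
Proof.
by move=> a b; rewrite -[a]piK -[b]piK !add_pi; apply/pi_eq/equiv_comm.
Qed.
Lemma add0 : left_id zero add.
Proof. by move=> a; rewrite -[a]piK add_pi. Qed.

Lemma lmul0 v : equiv (lmul 0 v) [::].
Proof.
elim: v => [|[a m] v IH] /=; first exact: equiv_refl.
rewrite mul0r; exact: (equiv_cat (equiv_0 m) IH).
Qed.

Lemma equiv_shuffle p q v w : equiv (p :: q :: v ++ w) ((p :: v) ++ (q :: w)).
Proof.
apply: (@equiv_cat [:: p] [:: p] (q :: v ++ w) (v ++ q :: w)).
  exact: equiv_refl.
have -> : v ++ q :: w = (v ++ [:: q]) ++ w by rewrite -catA.
apply: (@equiv_cat (q :: v) (v ++ [:: q]) w w); last exact: equiv_refl.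
exact: (equiv_comm [:: q] v).
Qed.

Lemma lmulDl g h v : equiv (lmul (g + h) v) (lmul g v ++ lmul h v).
Proof.
elim: v => [|[a m] v IH]; first exact: equiv_refl.
apply: equiv_trans (equiv_shuffle (g * a, m) (h * a, m) (lmul g v) (lmul h v)).
have -> : lmul (g + h) ((a, m) :: v)
    = [:: (g * a + h * a, m)] ++ lmul (g + h) v by rewrite -mulrDl.
exact: equiv_cat (equiv_Dl (g * a) (h * a) m) IH.
Qed.

Lemma lmul1 v : lmul 1 v = v.
Proof. by elim: v => [|[a m] v IH] //=; rewrite mul1r IH. Qed.

Lemma lmulM g h v : lmul g (lmul h v) = lmul (g * h) v.
Proof. by elim: v => [|[a m] v IH] //=; rewrite mulrA IH. Qed.

Lemma addN : left_inverse zero opp add.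
Proof.
move=> a; rewrite -[a]piK /opp scale_pi add_pi.
apply/pi_eq; rewrite -[X in _ ++ X]lmul1.
apply: equiv_trans (equiv_sym (lmulDl _ _ _)) _.
by rewrite addNr; apply: lmul0.
Qed.
#[export] HB.instance Definition _ := GRing.isZmodule.Build ind addA addC add0 addN.

Lemma scaleA g h a : scale g (scale h a) = scale (g * h) a.
Proof. by rewrite -[a]piK !scale_pi lmulM. Qed.
Lemma scale1 : left_id 1 scale.
Proof. by move=> a; rewrite -[a]piK scale_pi lmul1. Qed.
Lemma scaleDr : right_distributive scale +%R.
Proof.
move=> h a b; rewrite -[a]piK -[b]piK [_ + _]add_pi !scale_pi.
by rewrite [RHS]add_pi /lmul map_cat.
Qed.
Lemma scaleDl a : {morph scale^~ a : g h / g + h}.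
Proof.
move=> g h /=; rewrite -[a]piK !scale_pi [RHS]add_pi.
by apply/pi_eq/lmulDl.
Qed.
#[export] HB.instance Definition _ :=
  GRing.Zmodule_isLmodule.Build H ind scaleA scale1 scaleDr scaleDl.

Definition tens (a : H) (m : M) : ind := pi [:: (a, m)].

Lemma tensDl a b m : tens (a + b) m = tens a m + tens b m.
Proof. by rewrite [RHS]add_pi; apply/pi_eq/equiv_Dl. Qed.
Lemma tensDr a m m' : tens a (m + m') = tens a m + tens a m'.
Proof. by rewrite [RHS]add_pi; apply/pi_eq/equiv_Dr. Qed.
Lemma tens_bal a h m m' : hy_act h m m' -> tens (a * h) m = tens a m'.
Proof. by move=> hm; apply/pi_eq/equiv_bal. Qed.
Lemma scale_tens h a m : h *: tens a m = tens (h * a) m.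
Proof. exact: scale_pi. Qed.

End Induced.

Module Exports.
HB.reexport.
End Exports.
End Induced.
Export Induced.Exports.

Notation ind := Induced.ind.
Notation tens := Induced.tens.

Section Polynomials.
Variables (K : fieldType) (n : nat).
Implicit Types (f g h : {mpoly K[n]}) (i k : 'I_n).

(* f^(tau_i) *)
Definition mneg i f : {mpoly K[n]} :=
  f \mPo [tuple if j == i then - 'X_j else 'X_j | j < n].

(* The q with h = g * q, if there is one (and then q is unique if g != 0). *)
Definition mquo h g : {mpoly K[n]} :=
  if pselect (exists q, h = g * q) is left gh then sval (cid gh) else 0.

Lemma mquoP h g : (exists q, h = g * q) -> g * mquo h g = h.
Proof. by rewrite /mquo; case: pselect => // gh _; case: cid. Qed.

Lemma mPo_dvd (p q : n.-tuple {mpoly K[n]}) g f :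
    (forall j, exists r, tnth p j - tnth q j = g * r) ->
  exists r, (f \mPo p) - (f \mPo q) = g * r.
Proof.
move=> gpq; pose cong a b := exists r : {mpoly K[n]}, a - b = g * r.
have congD a b a' b' : cong a b -> cong a' b' -> cong (a + a') (b + b').
  by move=> [r ar] [r' ar']; exists (r + r'); rewrite opprD addrACA ar ar' mulrDr.
have congM a b a' b' : cong a b -> cong a' b' -> cong (a * a') (b * b').
  move=> [r ar] [r' ar']; exists (r * a' + b * r').
  by rewrite mulrDr mulrA -ar mulrCA -ar' mulrBl mulrBr addrA subrK.
have cong_refl a : cong a a by exists 0; rewrite subrr mulr0.
suff: cong (f \mPo p) (f \mPo q) by [].
rewrite !comp_mpolyE; apply: (big_ind2 cong (cong_refl 0) congD) => m _.
rewrite -!mul_mpolyC; apply: (congM _ _ _ _) => //.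
apply: (big_ind2 cong (cong_refl 1) congM) => j _.
by elim: (m j) => [|d IH] //; rewrite !exprS; apply: (congM _ _ _ _) => //.
Qed.

Lemma msymE s f : msym s f = f \mPo [tuple 'X_(s j) | j < n].
Proof.
rewrite -[LHS]comp_mpoly_id msym_mPo; congr (_ \mPo _).
by apply: eq_from_tnth => j; rewrite !tnth_mktuple.
Qed.

Lemma mquo_tau i f : 'X_i *+ 2 * mquo (f - mneg i f) ('X_i *+ 2) = f - mneg i f.
Proof.
apply: mquoP; rewrite -{1}[f]comp_mpoly_id; apply: mPo_dvd => j.
rewrite !tnth_mktuple; case: eqP => [->|_]; last by exists 0; rewrite subrr mulr0.
by exists 1; rewrite mulr1 opprK.
Qed.

Lemma mquo_sym i k f :
  ('X_i - 'X_k) * mquo (f - msym (tperm k i) f) ('X_i - 'X_k)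
  = f - msym (tperm k i) f.
Proof.
apply: mquoP; rewrite msymE -{1}[f]comp_mpoly_id; apply: mPo_dvd => j.
rewrite !tnth_mktuple; case: tpermP => [->|->|_ _].
- by exists (- 1); rewrite mulrN1 opprB.
- by exists 1; rewrite mulr1.
- by exists 0; rewrite subrr mulr0.
Qed.

Lemma mneg_mPo i f (p : n.-tuple {mpoly K[n]}) :
  mneg i (f \mPo p) = f \mPo [tuple mneg i (tnth p j) | j < n].
Proof.
rewrite /mneg [f \mPo p]comp_mpolyE [RHS]comp_mpolyE rmorph_sum /=.
apply: eq_bigr => m _; rewrite comp_mpolyZ rmorph_prod; congr (_ *: _).
by apply: eq_bigr => j _; rewrite rmorphXn /= tnth_mktuple.
Qed.

Lemma mnegX i j : mneg i 'X_j = if j == i then - 'X_j else 'X_j.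
Proof. by rewrite /mneg comp_mpolyXU -tnth_nth tnth_mktuple. Qed.

Lemma mquo_sym_tau i k f : k != i ->
  let g := mneg k (mneg i (msym (tperm k i) f)) in
  ('X_i + 'X_k) * mquo (f - g) ('X_i + 'X_k) = f - g.
Proof.
move=> ki /=; apply: mquoP; rewrite msymE !mneg_mPo -{1}[f]comp_mpoly_id.
apply: mPo_dvd => j; rewrite !tnth_mktuple mnegX.
have mnegN l h : mneg l (- h) = - mneg l h by rewrite /mneg rmorphN.
case: tpermP => [->|->|/eqP jk /eqP ji].
- rewrite eqxx mnegN mnegX eq_sym (negPf ki); exists 1.
  by rewrite mulr1 opprK addrC.
- by rewrite (negPf ki) mnegX eqxx; exists 1; rewrite mulr1 opprK.
- by rewrite (negPf ji) mnegX (negPf jk); exists 0; rewrite subrr mulr0.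
Qed.

End Polynomials.

Section Dunkl.
Variables (K : fieldType) (n : nat) (t u : K).
Local Notation H := (hcc n t u).

Definition hcc_poly (f : {mpoly K[n]}) : H :=
  \sum_(m <- msupp f) f@_m *: \prod_(i < n) hcc_x t u i ^+ m i.

End Dunkl.

Section DunklTheory.
Variables (K : fieldType) (n : nat) (t u : K).
Local Notation H := (hcc n t u).
Implicit Types (f g : {mpoly K[n]}) (i j k : 'I_n).

Lemma hcc_scalerAl (a : K) (g h : H) : a *: (g * h) = (a *: g) * h.
Proof. exact: Presented.algZAl. Qed.

Lemma hcc_scalerAr (a : K) (g h : H) : a *: (g * h) = g * (a *: h).
Proof. exact: Presented.algZAr. Qed.

Lemma hcc_xxE i j : hcc_x t u i * hcc_x t u j = hcc_x t u j * hcc_x t u i.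
Proof.
have ij : hcc_pres t u _ _ := hcc_xx _ _ _ _ _ _ _ i j.
exact: (Presented.pi_relM ij).
Qed.

Lemma hcc_cxE i j : hcc_c t u i * hcc_x t u j
  = (if j == i then - hcc_x t u j else hcc_x t u j) * hcc_c t u i.
Proof.
rewrite eq_sym.
have ij : hcc_pres t u _ _ := hcc_cx _ _ _ _ _ _ _ i j.
exact: (Presented.pi_relMsign ij).
Qed.

Local Notation poly := (@hcc_poly K n t u).
Local Notation mono m := (\prod_(i < n) hcc_x t u i ^+ m i).

Lemma hcc_polywE w f : (msize f <= w)%N ->
  poly f = \sum_(m : 'X_{1..n < w}) f@_m *: mono m.
Proof.
move=> le_fw; rewrite /hcc_poly (big_mksub 'X_{1..n < w}) ?msupp_uniq //=.
  rewrite big_rmcond //= => m /memN_msupp_eq0 ->.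
  by rewrite scale0r.
by move=> m /msize_mdeg_lt /leq_trans; apply.
Qed.

Lemma hcc_polyP a f g :
  poly (a *: f + g) = a *: poly f + poly g.
Proof.
pose w := maxn (msize (a *: f + g)) (maxn (msize f) (msize g)).
rewrite !(@hcc_polywE w) ?leq_max ?leqnn ?orbT //.
rewrite scaler_sumr -big_split; apply: eq_bigr => m _ /=.
by rewrite mcoeffD mcoeffZ scalerDl scalerA.
Qed.

Lemma hcc_poly0 : poly (0 : {mpoly K[n]}) = 0.
Proof. by rewrite /hcc_poly -mpolyC0 msupp0 big_nil. Qed.

Lemma hcc_polyZ a f : poly (a *: f) = a *: poly f.
Proof.
have h0 := hcc_poly0.
by rewrite -[a *: f]addr0 hcc_polyP h0 addr0.
Qed.

Lemma hcc_polyD f g : poly (f + g) = poly f + poly g.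
Proof. by rewrite -[f]scale1r hcc_polyP !scale1r. Qed.

Lemma hcc_polyN f : poly (- f) = - poly f.
Proof. by rewrite -scaleN1r hcc_polyZ scaleN1r. Qed.

Lemma hcc_polyX m : poly 'X_[m] = mono m.
Proof. by rewrite /hcc_poly msuppX big_seq1 mcoeffX eqxx scale1r. Qed.

Lemma hcc_poly1 : poly (1 : {mpoly K[n]}) = 1.
Proof.
by rewrite -mpolyX0 hcc_polyX big1 // => j _; rewrite mnm0E expr0.
Qed.

Lemma hcc_polyXM m m' :
  poly ('X_[m] * 'X_[m']) = poly 'X_[m] * poly 'X_[m'].
Proof.
rewrite -mpolyXD !hcc_polyX.
rewrite (eq_bigr (fun j => hcc_x t u j ^+ m j * hcc_x t u j ^+ m' j)); last first.
  by move=> j _; rewrite mnmDE exprD.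
elim: (index_enum _) => [|j s IH]; first by rewrite !big_nil mulr1.
rewrite !big_cons {}IH !mulrA; congr (_ * _); rewrite -!mulrA; congr (_ * _).
apply: commr_sym; apply: commrX; apply: commr_sym; apply: commr_prod => l _.
by apply: commrX; apply: hcc_xxE.
Qed.

Lemma hcc_polyM f g : poly (f * g) = poly f * poly g.
Proof.
have h0 := hcc_poly0.
elim/mpolyind: f => [|a m f _ _ IH]; first by rewrite mul0r h0 mul0r.
rewrite mulrDl -scalerAl !hcc_polyP IH mulrDl; congr (_ + _).
rewrite -hcc_scalerAl; congr (_ *: _).
elim/mpolyind: g {IH} => [|b m' g _ _ IH]; first by rewrite mulr0 h0 mulr0.
by rewrite mulrDr -scalerAr !hcc_polyP IH mulrDr -hcc_scalerAr hcc_polyXM.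
Qed.

Lemma hcc_polyXU j : poly 'X_j = hcc_x t u j.
Proof.
rewrite hcc_polyX.
have E (s : seq 'I_n) : uniq s ->
    \prod_(l <- s) hcc_x t u l ^+ U_(j)%MM l = hcc_x t u j ^+ (j \in s).
  elim: s => [|l s IH]; first by rewrite big_nil expr0.
  rewrite big_cons inE mnm1E /= => /andP[ls /IH ->].
  by case: eqVneq ls => [->|jl]; [move=> /negPf -> /=; rewrite mulr1|rewrite expr0 mul1r].
by rewrite E ?index_enum_uniq // mem_index_enum expr1.
Qed.

Lemma hcc_c_poly i f :
  hcc_c t u i * poly f = poly (mneg i f) * hcc_c t u i.
Proof.
have h0 := hcc_poly0.
have E m : hcc_c t u i * poly 'X_[m]
    = poly (mneg i 'X_[m]) * hcc_c t u i.
  rewrite mpolyXE_id /mneg rmorph_prod /=.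
  apply: (big_rec2 (fun f g => hcc_c t u i * poly g
    = poly f * hcc_c t u i)) => [|j f1 f2 _ IH].
    by rewrite !hcc_poly1 mul1r mulr1.
  rewrite !hcc_polyM; rewrite -[RHS]mulrA -IH !mulrA; congr (_ * _).
  rewrite rmorphXn /= -/(mneg i 'X_j) mnegX.
  elim: (m j) => [|d IHd]; first by rewrite !expr0 hcc_poly1 mul1r mulr1.
  rewrite !exprS !hcc_polyM hcc_polyXU mulrA hcc_cxE -!mulrA; congr (_ * _).
    by case: (_ == _); rewrite ?hcc_polyN hcc_polyXU.
  exact: IHd.
elim/mpolyind: f => [|a m f _ _ IH].
  by rewrite /mneg comp_mpoly0 h0 mulr0 mul0r.
rewrite /mneg comp_mpolyD comp_mpolyZ -!/(mneg _ _) !hcc_polyP mulrDr mulrDl.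
by rewrite IH -hcc_scalerAr -hcc_scalerAl E.
Qed.

(* (f c_k c_i - c_k c_i f^(s_ki)) / (x_i + x_k): moving c_k c_i to the right
   turns f^(s_ki) into mneg k (mneg i (f^(s_ki))); see clifford_quoP. *)
Definition clifford_quo (f : {mpoly K[n]}) (i k : 'I_n) : H :=
  hcc_poly t u
    (mquo (f - mneg k (mneg i (msym (tperm k i) f))) ('X_i + 'X_k))
  * (hcc_c t u k * hcc_c t u i).

Lemma clifford_quoP f i k : k != i ->
  (hcc_x t u i + hcc_x t u k) * clifford_quo f i k
  = hcc_poly t u f * (hcc_c t u k * hcc_c t u i)
    - hcc_c t u k * hcc_c t u i * hcc_poly t u (msym (tperm k i) f).
Proof.
move=> ki; rewrite /clifford_quo mulrA -!hcc_polyXU -hcc_polyD -hcc_polyM.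
rewrite mquo_sym_tau // hcc_polyD hcc_polyN mulrBl; congr (_ - _).
by rewrite -[in RHS]mulrA hcc_c_poly 2!mulrA hcc_c_poly.
Qed.

End DunklTheory.

(* Main.v *)
Require Import Defs.
From HB Require Import structures.
From mathcomp Require Import all_boot all_order all_algebra all_fingroup.
From mathcomp Require Import reals complex mpoly.

(** The operator y_i kills 1 (x) M, so y_i acts on f (x) m through the commutator
[y_i, f] alone, and everything reduces to computing this commutator in the
algebra ([commutator_y_poly]).

Both sides of the commutator formula are derivations from the polynomial ring
to the algebra, where a polynomial multiplies on either side
([is_derivation]); since two derivations that agree on the variables are equal
([is_derivation_eq]), and since the defining relations give [y_i, x_j], nothing
is left but to evaluate the Dunkl operator on each x_j.

That the Dunkl operator is a derivation has one cause for all its terms.  Each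
is f |-> ((f - f^sigma) / g) Z, where sigma is an automorphism of the polynomial
ring (a sign change of one variable, a transposition, or a transposition with
two sign changes) and Z is an element of the algebra with Z f = f^sigma Z.  The
divided difference satisfies the twisted Leibniz rule
   (fh - (fh)^sigma) / g = (f - f^sigma)/g h^sigma + f (h - h^sigma)/g
([mquo_twisted_leibniz]), and Z carries the twist h^sigma back to h on its
right ([quotient_derivation]).  The three choices of Z are c_i e_i,
(1 + e_k e_i) s_ki and c_k c_i (1 + e_k e_i) s_ki. *)

Set Implicit Arguments.
Unset Strict Implicit.
Unset Printing Implicit Defensive.

Import GRing.Theory.
Local Open Scope ring_scope.

(** * Polynomials and divided differences *)

Lemma mpoly_alg_ind (K : fieldType) (n : nat) (Q : {mpoly K[n]} -> Prop) :
    Q 1 -> (forall j, Q 'X_j) ->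
    (forall a f g, Q f -> Q g -> Q (a *: f + g)) ->
    (forall f g, Q f -> Q g -> Q (f * g)) ->
  forall f, Q f.
Proof.
move=> Q1 QX Qlin QM; elim/mpolyind => [|a m f _ _ Qf].
  by rewrite -(addNr 1) -scaleN1r; apply: Qlin.
apply: Qlin => //; rewrite mpolyXE_id; apply: (big_ind Q) => // j _.
by elim: (m j) => [|d IH] //; rewrite exprS; apply: QM.
Qed.

Lemma mneg_is_linear (K : fieldType) (n : nat) (i : 'I_n) : linear (@mneg K n i).
Proof. by move=> a f g; rewrite /mneg linearP. Qed.

Lemma mneg_is_monoid_morphism (K : fieldType) (n : nat) (i : 'I_n) :
  monoid_morphism (@mneg K n i).
Proof. by split=> [|f g]; rewrite /mneg ?rmorph1 ?rmorphM. Qed.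

HB.instance Definition _ (K : fieldType) (n : nat) (i : 'I_n) :=
  GRing.isLinear.Build K {mpoly K[n]} {mpoly K[n]} *:%R (mneg i)
    (@mneg_is_linear K n i).
HB.instance Definition _ (K : fieldType) (n : nat) (i : 'I_n) :=
  GRing.isMonoidMorphism.Build {mpoly K[n]} {mpoly K[n]} (mneg i)
    (@mneg_is_monoid_morphism K n i).

Lemma msymXU (K : fieldType) (n : nat) (s : 'S_n) (j : 'I_n) :
  msym s 'X_j = 'X_(s j) :> {mpoly K[n]}.
Proof. by rewrite Defs.msymE comp_mpolyXU -tnth_nth tnth_mktuple. Qed.

Lemma mpolyXUD_neq0 (K : fieldType) (n : nat) (a : K) (i k : 'I_n) :
  k != i -> 'X_i + a *: 'X_k != 0 :> {mpoly K[n]}.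
Proof.
move=> ki; apply/eqP => /(congr1 (fun f => f@_U_(i)))/eqP.
by rewrite mcoeffD mcoeffZ !mcoeffXU eqxx (negPf ki) mulr0 addr0 mcoeff0 oner_eq0.
Qed.

Section Quotients.
Variables (K : fieldType) (n : nat).
Implicit Types (f g h q : {mpoly K[n]}).

Lemma mquo_eq g h q : g != 0 -> h = g * q -> mquo h g = q.
Proof. by move=> g0 hq; apply: (mulfI g0); rewrite mquoP //; exists q. Qed.

Variables (sigma : {lrmorphism {mpoly K[n]} -> {mpoly K[n]}}) (g : {mpoly K[n]}).
Hypotheses (g0 : g != 0)
  (g_dvd : forall f, g * mquo (f - sigma f) g = f - sigma f).

Lemma mquo_linear a f h :
  mquo (a *: f + h - sigma (a *: f + h)) g
  = a *: mquo (f - sigma f) g + mquo (h - sigma h) g.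
Proof.
apply: mquo_eq => //.
by rewrite mulrDr -scalerAr !g_dvd linearP /= scalerBr opprD addrACA.
Qed.

Lemma mquo_twisted_leibniz f h :
  mquo (f * h - sigma (f * h)) g
  = mquo (f - sigma f) g * sigma h + f * mquo (h - sigma h) g.
Proof.
apply: mquo_eq => //.
rewrite mulrDr mulrA g_dvd mulrCA g_dvd rmorphM /= mulrBl mulrBr.
by rewrite [RHS]addrC addrA subrK.
Qed.

End Quotients.

(** * Relations in the algebra *)

(** The next lemmas carry the defining relations from the free algebra to its
quotient.  They are stated for an abstract source ring A so that rewriting never
compares, and hence never unfolds, products of the free algebra. *)
Section RelationImages.
Variables (K : nzRingType) (A : lalgType K) (B : pzRingType).
Variables (scl : K -> B -> B) (phi : A -> B).
Hypotheses (phiB : {morph phi : a b / a - b}) (phiD : {morph phi : a b / a + b})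
  (phiM : {morph phi : a b / a * b}) (phi1 : phi 1 = 1)
  (phiZ : forall k, {morph phi : a / k *: a >-> scl k a}).
Implicit Types a b x y s : A.

Let phi0 : phi 0 = 0. Proof. by rewrite -[X in phi X](subrr 0) phiB subrr. Qed.

Lemma image_anticomm a b :
  phi (a * b) = phi (- (b * a)) -> phi a * phi b = - (phi b * phi a).
Proof. by rewrite -[- (b * a)]add0r phiB phi0 sub0r !phiM. Qed.

Lemma image_yx_neq (k : K) x y a a' b b' s :
    phi (y * x - x * y) = phi (k *: ((1 + a * a') * (1 + b * b') * s)) ->
  phi y * phi x - phi x * phi y
  = scl k ((1 + phi a * phi a') * (1 + phi b * phi b') * phi s).
Proof. by rewrite phiB phiZ !(phiM, phiD, phi1). Qed.

Lemma image_yx_eq (n : nat) (k l : K) (i : 'I_n) x y (c e s : 'I_n -> A) :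
    phi (y * x - x * y)
    = phi (k *: (c i * e i) - l *: \sum_(j < n | j != i)
                                    (1 + c j * c i) * (1 + e j * e i) * s j) ->
  phi y * phi x - phi x * phi y
  = scl k (phi (c i) * phi (e i))
    - scl l (\sum_(j < n | j != i)
        (1 + phi (c j) * phi (c i)) * (1 + phi (e j) * phi (e i)) * phi (s j)).
Proof.
rewrite !phiB !phiZ !phiM => ->; congr (_ - scl _ _).
rewrite (big_morph _ phiD phi0).
by apply: eq_bigr => j _; rewrite !(phiM, phiD, phi1).
Qed.

End RelationImages.

Section Derivations.
Variables (K : fieldType) (n : nat) (t u : K).
Local Notation H := (hcc n t u).
Local Notation poly := (hcc_poly t u).
Implicit Types (f g h : {mpoly K[n]}) (Z : H) (D : {mpoly K[n]} -> H)
  (i j k : 'I_n).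

Lemma hcc_sxE (s : 'S_n) j :
  hcc_s t u s * hcc_x t u j = hcc_x t u (s j) * hcc_s t u s.
Proof.
have sj : hcc_pres t u _ _ := hcc_sx _ _ _ _ _ _ _ s j.
exact: (Presented.pi_relM sj).
Qed.

Lemma hcc_exE i j : hcc_e t u i * hcc_x t u j = hcc_x t u j * hcc_e t u i.
Proof.
have ij : hcc_pres t u _ _ := hcc_ex _ _ _ _ _ _ _ i j.
exact: (Presented.pi_relM ij).
Qed.

Local Notation Hpi := (Presented.pi (hcc_pres t u)).

Lemma hcc_ccE i j : i != j ->
  hcc_c t u i * hcc_c t u j = - (hcc_c t u j * hcc_c t u i).
Proof.
move=> ij.
have r : hcc_pres t u _ _ := hcc_smash t u _ _ (smash_cc _ _ _ ij).
exact: (@image_anticomm K _ H Hpi (Presented.piB _) (Presented.algM _) _ _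
  (Presented.pi_rel r)).
Qed.

Lemma hcc_yxE_neq i j : i != j ->
  hcc_y t u i * hcc_x t u j - hcc_x t u j * hcc_y t u i
  = u *: ((1 + hcc_c t u i * hcc_c t u j) * (1 + hcc_e t u j * hcc_e t u i)
          * hcc_s t u (tperm i j)).
Proof.
move=> ij.
have r : hcc_pres t u _ _ := hcc_yx_neq _ _ _ _ _ _ _ ij.
exact: (@image_yx_neq K _ H *:%R Hpi (Presented.piB _) (Presented.piD _)
  (Presented.algM _) (Presented.alg1 _) (Presented.algZ _) _ _ _ _ _ _ _ _
  (Presented.pi_rel r)).
Qed.

Lemma hcc_yxE_eq i :
  hcc_y t u i * hcc_x t u i - hcc_x t u i * hcc_y t u i
  = t *: (hcc_c t u i * hcc_e t u i)
    - u *: \sum_(k < n | k != i)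
        (1 + hcc_c t u k * hcc_c t u i) * (1 + hcc_e t u k * hcc_e t u i)
        * hcc_s t u (tperm k i).
Proof.
have r : hcc_pres t u _ _ := hcc_yx_eq _ _ _ _ _ _ _ i.
exact: (@image_yx_eq K _ H *:%R Hpi (Presented.piB _) (Presented.piD _)
  (Presented.algM _) (Presented.alg1 _) (Presented.algZ _) n _ _ i _ _ _ _ _
  (Presented.pi_rel r)).
Qed.

(** * Elements implementing automorphisms of the polynomial ring *)

Definition intertwines Z (sigma : {mpoly K[n]} -> {mpoly K[n]}) :=
  forall f, Z * poly f = poly (sigma f) * Z.

Lemma intertwinesM Z Z' sigma sigma' : intertwines Z sigma ->
  intertwines Z' sigma' -> intertwines (Z * Z') (sigma \o sigma').
Proof. by move=> Zs Zs' f; rewrite -mulrA Zs' mulrA Zs mulrA. Qed.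

(** An algebra morphism is determined by its values on the variables, so the
intertwining relation may be checked there. *)
Lemma intertwines_gen Z (sigma : {lrmorphism {mpoly K[n]} -> {mpoly K[n]}}) :
    (forall j, Z * hcc_x t u j = poly (sigma 'X_j) * Z) ->
  intertwines Z sigma.
Proof.
move=> ZX; elim/mpoly_alg_ind => [|j|a f g Zf Zg|f g Zf Zg].
- by rewrite rmorph1 hcc_poly1 mulr1 mul1r.
- by rewrite hcc_polyXU ZX.
- rewrite linearP !hcc_polyP mulrDr mulrDl Zg -hcc_scalerAr Zf.
  by rewrite hcc_scalerAl.
- by rewrite rmorphM !hcc_polyM mulrA Zf -!mulrA Zg.
Qed.

Lemma intertwines_s (s : 'S_n) : intertwines (hcc_s t u s) (msym s).
Proof.
by apply: intertwines_gen => j; rewrite /= msymXU hcc_polyXU hcc_sxE.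
Qed.

Lemma intertwines_e i : intertwines (hcc_e t u i) idfun.
Proof. by apply: intertwines_gen => j; rewrite /= hcc_polyXU hcc_exE. Qed.

Lemma intertwines_c i : intertwines (hcc_c t u i) (mneg i).
Proof. exact: hcc_c_poly. Qed.

(** The factor (1 + e_k e_i) s_ki that stands at the right of every term of the
sum over k.  As e_k and e_i commute with every x_j, it implements the same
automorphism as s_ki. *)
Definition swap_e i k : H :=
  (1 + hcc_e t u k * hcc_e t u i) * hcc_s t u (tperm k i).

Lemma intertwines_swap_e i k : intertwines (swap_e i k) (msym (tperm k i)).
Proof.
apply: (@intertwinesM _ _ idfun) (intertwines_s _) => f.
by rewrite mulrDl mulrDr mul1r mulr1
  (intertwinesM (intertwines_e k) (intertwines_e i)).
Qed.

(** * Derivations into the algebra *)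

(** Linear maps satisfying the Leibniz rule for the bimodule structure given by
left and right multiplication by polynomials. *)
Definition is_derivation D :=
  (forall a f g, D (a *: f + g) = a *: D f + D g)
  /\ (forall f g, D (f * g) = D f * poly g + poly f * D g).

(** The variables generate the polynomial ring, and a derivation vanishes on 1
because 1 = 1 * 1. *)
Lemma is_derivation_eq D D' : is_derivation D -> is_derivation D' ->
  (forall j, D 'X_j = D' 'X_j) -> D =1 D'.
Proof.
move=> [Dlin DM] [D'lin D'M] DX; apply: mpoly_alg_ind => //.
- have D1 E : (forall f g, E (f * g) = E f * poly g + poly f * E g) -> E 1 = 0.
    move=> /(_ 1 1); rewrite mulr1 hcc_poly1 mulr1 mul1r => /eqP.
    by rewrite -[X in X == _]addr0 (inj_eq (addrI _)) => /eqP.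
  by rewrite !D1.
- by move=> a f g Df Dg; rewrite Dlin D'lin Df Dg.
- by move=> f g Df Dg; rewrite DM D'M Df Dg.
Qed.

Lemma is_derivation_ext D D' : D =1 D' -> is_derivation D -> is_derivation D'.
Proof. by move=> DD' [Dlin DM]; split=> [a f g|f g]; rewrite -!DD'. Qed.

Lemma is_derivationD D D' : is_derivation D -> is_derivation D' ->
  is_derivation (fun f => D f + D' f).
Proof.
move=> [Dlin DM] [D'lin D'M]; split=> [a f g|f g].
  by rewrite Dlin D'lin scalerDr addrACA.
by rewrite DM D'M mulrDl mulrDr addrACA.
Qed.

Lemma is_derivationZ (b : K) D :
  is_derivation D -> is_derivation (fun f => b *: D f).
Proof.
move=> [Dlin DM]; split=> [a f g|f g].
  by rewrite Dlin scalerDr !scalerA mulrC.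
by rewrite DM scalerDr hcc_scalerAl hcc_scalerAr.
Qed.

Lemma is_derivation_sum (I : finType) (P : pred I) (D : I -> {mpoly K[n]} -> H) :
  (forall l, P l -> is_derivation (D l)) ->
  is_derivation (fun f => \sum_(l | P l) D l f).
Proof.
move=> PD; split=> [a f g|f g].
  rewrite scaler_sumr -big_split; apply: eq_bigr => l /PD[Dlin _]; exact: Dlin.
rewrite mulr_suml mulr_sumr -big_split; apply: eq_bigr => l /PD[_ DM]; exact: DM.
Qed.

Lemma commutator_derivation Z :
  is_derivation (fun f => Z * poly f - poly f * Z).
Proof.
split=> [a f g|f g].
  by rewrite hcc_polyP mulrDr mulrDl -hcc_scalerAr -hcc_scalerAl scalerBr
    opprD addrACA.
by rewrite hcc_polyM mulrBl mulrBr !mulrA addrA subrK.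
Qed.

(** The twist sigma of the Leibniz rule for divided differences disappears
because Z, standing to the right of h^sigma, satisfies h^sigma Z = Z h. *)
Lemma quotient_derivation (sigma : {lrmorphism {mpoly K[n]} -> {mpoly K[n]}}) g Z :
    g != 0 -> (forall f, g * mquo (f - sigma f) g = f - sigma f) ->
    intertwines Z sigma ->
  is_derivation (fun f => poly (mquo (f - sigma f) g) * Z).
Proof.
move=> g0 g_dvd Zs; split=> [a f h|f h].
  by rewrite mquo_linear // hcc_polyP mulrDl hcc_scalerAl.
by rewrite mquo_twisted_leibniz // hcc_polyD !hcc_polyM mulrDl -!mulrA Zs.
Qed.

(** * The Dunkl operator *)

Hypothesis two_neq0 : (2 : K) != 0.

Lemma double_X_neq0 i : 'X_i *+ 2 != 0 :> {mpoly K[n]}.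
Proof.
apply/eqP => /(congr1 (fun f => f@_U_(i)))/eqP.
by rewrite mcoeffMn mcoeffXU eqxx mcoeff0 (negPf two_neq0).
Qed.

Lemma mneg_involutive i : involutive (@mneg K n i).
Proof.
apply: mpoly_alg_ind => [|j|a f g Hf Hg|f g Hf Hg].
- by rewrite !rmorph1.
- rewrite mnegX; case: eqP => [->|/eqP/negPf ji].
    by rewrite rmorphN /= mnegX eqxx opprK.
  by rewrite mnegX ji.
- by rewrite !linearP /= Hf Hg.
- by rewrite !rmorphM /= Hf Hg.
Qed.

(** Under x_i |-> - x_i both the numerator f - f^tau and the denominator 2 x_i
change sign. *)
Lemma mneg_mquo_tau i f :
  mneg i (mquo (f - mneg i f) ('X_i *+ 2)) = mquo (f - mneg i f) ('X_i *+ 2).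
Proof.
apply: (mulfI (double_X_neq0 i)); rewrite mquo_tau; apply: oppr_inj.
rewrite -mulNr -mulNrn.
have -> : - 'X_i *+ 2 = mneg i ('X_i *+ 2) :> {mpoly K[n]}
  by rewrite rmorphMn /= mnegX eqxx.
by rewrite -rmorphM mquo_tau rmorphB /= mneg_involutive opprB.
Qed.

(** The Dunkl operator has c_i e_i on the left of the quotient, whereas
[quotient_derivation] needs the intertwiner on the right; for an even quotient
the two agree. *)
Lemma ce_mquo_tau i f : let q := mquo (f - mneg i f) ('X_i *+ 2) in
  hcc_c t u i * hcc_e t u i * poly q = poly q * (hcc_c t u i * hcc_e t u i).
Proof.
by rewrite /= (intertwinesM (intertwines_c i) (intertwines_e i)) /= mneg_mquo_tau.
Qed.

(** The commutator [y_i, f] as an element of the algebra: the factors that act on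
M in the module are kept here as right factors [swap_e i k]. *)
Definition dunkl i f : H :=
  t *: (poly (mquo (f - mneg i f) ('X_i *+ 2)) * (hcc_c t u i * hcc_e t u i))
  + (- u) *: \sum_(k < n | k != i)
     (poly (mquo (f - msym (tperm k i) f) ('X_i - 'X_k)) * swap_e i k
      + clifford_quo t u f i k * swap_e i k).

Lemma dunkl_derivation i : is_derivation (dunkl i).
Proof.
apply: is_derivationD; apply: is_derivationZ.
  apply: quotient_derivation (double_X_neq0 i) (mquo_tau i) _.
  exact: intertwinesM (intertwines_c i) (intertwines_e i).
apply: is_derivation_sum => k ki; apply: is_derivationD.
  apply: quotient_derivation (mquo_sym i k) (intertwines_swap_e i k).
  by rewrite -scaleN1r; apply: mpolyXUD_neq0.
have Z := intertwinesM (intertwinesM (intertwines_c k) (intertwines_c i))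
  (intertwines_swap_e i k).
have ik0 : 'X_i + 'X_k != 0 :> {mpoly K[n]}.
  by rewrite -['X_k]scale1r; apply: mpolyXUD_neq0.
have DZ := @quotient_derivation (mneg k \o mneg i \o msym (tperm k i)) _ _ ik0
  (fun f => mquo_sym_tau f ki) Z.
by apply: is_derivation_ext DZ => f; rewrite mulrA.
Qed.

Lemma hcc_poly_bool (b : bool) : poly (b%:R : {mpoly K[n]}) = b%:R :> H.
Proof. by case: b; rewrite ?hcc_poly1 ?hcc_poly0. Qed.

Lemma mquo_tauX i j :
  mquo ('X_j - mneg i 'X_j) ('X_i *+ 2) = (j == i)%:R :> {mpoly K[n]}.
Proof.
apply: mquo_eq (double_X_neq0 i) _; rewrite mnegX.
by case: eqP => [->|_]; rewrite ?opprK ?mulr1 ?subrr ?mulr0.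
Qed.

Lemma mquo_symX i k j : k != i ->
  mquo ('X_j - msym (tperm k i) 'X_j) ('X_i - 'X_k)
  = (j == i)%:R - (j == k)%:R :> {mpoly K[n]}.
Proof.
move=> ki; apply: mquo_eq; first by rewrite -scaleN1r; apply: mpolyXUD_neq0.
rewrite msymXU; case: tpermP => [->|->|/eqP/negPf-> /eqP/negPf->].
- by rewrite eqxx (negPf ki) sub0r mulrN1 opprB.
- by rewrite eqxx eq_sym (negPf ki) subr0 mulr1.
- by rewrite !subrr mulr0.
Qed.

Lemma clifford_quoX i k j : k != i ->
  clifford_quo t u 'X_j i k
  = ((j == i)%:R + (j == k)%:R) * (hcc_c t u k * hcc_c t u i).
Proof.
move=> ki; rewrite /clifford_quo -!hcc_poly_bool -hcc_polyD; congr (poly _ * _).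
apply: mquo_eq; first by rewrite -['X_k]scale1r; apply: mpolyXUD_neq0.
have ik : (i == k) = false by rewrite eq_sym (negPf ki).
rewrite msymXU; case: tpermP => [->|->|/eqP jk /eqP ji].
- by rewrite mnegX !eqxx rmorphN /= mnegX ik (negPf ki) opprK add0r mulr1 addrC.
- by rewrite mnegX (negPf ki) mnegX !eqxx ik addr0 opprK mulr1.
- by rewrite mnegX (negPf ji) mnegX (negPf jk) subrr addr0 mulr0.
Qed.

(** On the variable x_j the formula is the defining relation for [y_i, x_j]: all
k contribute to it if j = i, and only k = j if j differs from i. *)
Lemma commutator_y_poly i f :
  hcc_y t u i * poly f - poly f * hcc_y t u i = dunkl i f.
Proof.
apply: (is_derivation_eq (commutator_derivation _) (dunkl_derivation i)) => j.
rewrite /dunkl mquo_tauX hcc_poly_bool hcc_polyXU scaleNr.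
have -> : \sum_(k < n | k != i)
     (poly (mquo ('X_j - msym (tperm k i) 'X_j) ('X_i - 'X_k)) * swap_e i k
      + clifford_quo t u 'X_j i k * swap_e i k)
  = \sum_(k < n | k != i)
     ((j == i)%:R - (j == k)%:R
      + ((j == i)%:R + (j == k)%:R) * (hcc_c t u k * hcc_c t u i)) * swap_e i k.
  apply: eq_bigr => k ki; rewrite mquo_symX // clifford_quoX //.
  by rewrite hcc_polyD hcc_polyN !hcc_poly_bool [RHS]mulrDl.
case: (eqVneq j i) => [->|ji].
  rewrite hcc_yxE_eq mul1r; congr (_ - _ *: _); apply: eq_bigr => k ki.
  by rewrite eq_sym (negPf ki) subr0 addr0 mul1r mulrA.
rewrite mul0r scaler0 sub0r -scalerN hcc_yxE_neq 1?eq_sym //; congr (_ *: _).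
rewrite (bigD1 j) //= big1 => [|k /andP[_ kj]]; last first.
  by rewrite eq_sym (negPf kj) subr0 addr0 mul0r add0r mul0r.
(* - u (- 1 + c_j c_i) = u (1 + c_i c_j), as c_i and c_j anticommute. *)
rewrite eqxx sub0r add0r mul1r addr0 -mulNr opprD opprK -hcc_ccE 1?eq_sym //.
by rewrite tpermC mulrA.
Qed.

End Derivations.

(** * The induced module *)

Section InducedModule.
Variables (K : fieldType) (n : nat) (t u : K) (M : lmodType (smash K n)).
Local Notation H := (hcc n t u).
Implicit Types (a : H) (m : M) (i k : 'I_n).

Lemma tens0r a : tens a (0 : M) = 0.
Proof.
have /eqP := Induced.tensDr a (0 : M) 0.
by rewrite addr0 -[X in X == _]addr0 (inj_eq (addrI _)) => /eqP.
Qed.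

Lemma tens0l m : tens (0 : H) m = 0.
Proof. by rewrite -[0 in LHS](mulr0 0) -Induced.scale_tens scale0r. Qed.

Lemma tensN a m : tens (- a) m = - tens a m.
Proof. by rewrite -mulN1r -Induced.scale_tens scaleN1r. Qed.

Lemma tens_sum (I : finType) (P : pred I) (a : I -> H) m :
  tens (\sum_(l | P l) a l) m = \sum_(l | P l) tens (a l) m.
Proof.
exact: (big_morph (fun a => tens a m) (fun a b => Induced.tensDl a b m) (tens0l m)).
Qed.

Lemma tens_scale (b : K) a m : tens (b *: a) m = (b *: (1 : H)) *: tens a m.
Proof. by rewrite Induced.scale_tens -hcc_scalerAl mul1r. Qed.

Lemma hy_act_swap_e i k m :
  hy_act (swap_e t u i k) m
    (((1 + smash_e K k * smash_e K i) * smash_s K (tperm k i)) *: m).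
Proof.
rewrite -scalerA; apply: hy_actM (hy_act_s _ _ _ _) _.
rewrite scalerDl; apply: hy_actD.
  have := hy_act_scalar t u 1 (smash_s K (tperm k i) *: m).
  by rewrite !scale1r.
rewrite -scalerA; exact: hy_actM (hy_act_e _ _ _ _) (hy_act_e _ _ _ _).
Qed.

End InducedModule.

Unset Implicit Arguments.

Theorem theorem3p12 (R : realType) (n : nat) (t u : R[i])
    (M : lmodType (smash R[i] n)) (i : 'I_n) (f : {mpoly R[i][n]}) (m : M) :
  (hcc_y t u i *: tens (hcc_poly t u f) m : ind t u M) =
  tens (t *: (hcc_c t u i * hcc_e t u i
              * hcc_poly t u (mquo (f - mneg i f) ('X_i *+ 2)))) m
  - (u *: (1 : hcc n t u)) *: \sum_(k < n | k != i)
      tens (hcc_poly t u (mquo (f - msym (tperm k i) f) ('X_i - 'X_k))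
            + clifford_quo t u f i k)
        (((1 + smash_e R[i] k * smash_e R[i] i) * smash_s R[i] (tperm k i))
         *: m).
Proof.
have two_neq0 : (2 : R[i]) != 0 by rewrite Num.Theory.pnatr_eq0.
(* y f = [y, f] + f y, and f y (x) m = f (x) y m = 0. *)
rewrite Induced.scale_tens -[_ * _](subrK (hcc_poly t u f * hcc_y t u i)).
rewrite commutator_y_poly // Induced.tensDl.
rewrite (Induced.tens_bal _ (hy_act_y _ _ _ _)) tens0r addr0.
rewrite /dunkl -(ce_mquo_tau t u two_neq0) scaleNr Induced.tensDl; congr (_ + _).
rewrite -scalerN tens_scale -scalerN; congr (_ *: _).
rewrite -!sumrN tens_sum; apply: eq_bigr => k _.
rewrite -mulrDl -mulNr (Induced.tens_bal _ (hy_act_swap_e _ _ _ _ _)).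
exact: tensN.
Qed.
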